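(* Let $(L,A,[\cdot,\cdot],\mu)$ be a Lie-Rinehart superalgebra, $\tau$ a supertrace of $L$ with $\tau(ax)y=\tau(x)ay$ for all $x,y\in\mathcal H(L)$, $a\in\mathcal H(A)$, and let $\varphi_1,\varphi_2\in Z^2_{LR}(L,\mathbb K)$. If $\varphi_1,\varphi_2$ are in the same cohomology class (for the scalar cohomology of the Lie-Rinehart superalgebra $L$), then $\psi_1,\psi_2$ defined for $i=1,2$ by $$\psi_i(x,y,z)=\tau(x)\varphi_i(y,z)-(-1)^{\bar x\bar y}\tau(y)\varphi_i(x,z)+(-1)^{\bar z(\bar x+\bar y)}\tau(z)\varphi_i(x,y)$$ are in the same cohomology class (for the scalar cohomology of the induced $3$-Lie-Rinehart superalgebra $(L,A,[\cdot,\cdot,\cdot]_\tau,\rho_\tau)$).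
   Context: $\mathbb K$ is the base field; all vector spaces are $\mathbb Z_2$-graded, $\bar v$ is the degree of a homogeneous element $v$, and $\mathcal H(V)$ is the set of homogeneous elements of $V$. In all identities the elements are homogeneous. Lie superalgebra: $\mathbb Z_2$-graded space with an even bilinear bracket with $[x,y]=-(-1)^{\bar x\bar y}[y,x]$ and $(-1)^{\bar x\bar z}[x,[y,z]]+(-1)^{\bar y\bar x}[y,[z,x]]+(-1)^{\bar z\bar y}[z,[x,y]]=0$. A representation on $V$ is an even linear map $\mu$ into $\mathfrak{gl}(V)$ with $\mu([x,y])=\mu(x)\mu(y)-(-1)^{\bar x\bar y}\mu(y)\mu(x)$. A supertrace is an even linear form $\tau$ with $\tau([x,y])=0$ for all $x,y$. Lie-Rinehart superalgebra $(L,A,[\cdot,\cdot],\mu)$: $A$ is an associative supercommutative superalgebra over $\mathbb K$, $L$ is a Lie superalgebra and an $A$-module, $\mu:L\to Der(A)$ (superderivations) is an even linear map that is a representation of $L$ on $A$, $\mu(ax)=a\mu(x)$, and $[x,ay]=\mu(x)(a)\,y+(-1)^{\bar a\bar x}a[x,y]$. Induced structure: $[x_1,x_2,x_3]_\tau=\tau(x_1)[x_2,x_3]-(-1)^{\bar x_1\bar x_2}\tau(x_2)[x_1,x_3]+(-1)^{\bar x_3(\bar x_1+\bar x_2)}\tau(x_3)[x_1,x_2]$ and $\rho_\tau(x,y)=\tau(x)\mu(y)-(-1)^{\bar x\bar y}\tau(y)\mu(x)$. Scalar cohomology means cohomology with coefficients in $\mathbb K$ with zero action. $Z^2_{LR}(L,\mathbb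 K)$ is the set of super skew-symmetric bilinear maps $\varphi:L\times L\to\mathbb K$ with $\varphi([x_1,x_2],x_3)-(-1)^{\bar x_2\bar x_3}\varphi([x_1,x_3],x_2)+(-1)^{\bar x_1(\bar x_2+\bar x_3)}\varphi([x_2,x_3],x_1)=0$. For a linear map $\nu:L\to\mathbb K$, $\delta_{LR}\nu(x,y)=\nu([x,y])$ and $\delta_{3LR}\nu(x,y,z)=\nu([x,y,z]_\tau)$. Two elements $\varphi_1,\varphi_2$ of $Z^2_{LR}(L,\mathbb K)$ are in the same cohomology class if $\varphi_2-\varphi_1=\delta_{LR}\nu$ for some linear $\nu:L\to\mathbb K$; $\psi_1,\psi_2$ are in the same cohomology class if $\psi_2-\psi_1=\delta_{3LR}\nu$ for some linear $\nu:L\to\mathbb K$. *)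

(* Defs.v *)
From HB Require Import structures.
From mathcomp Require Import all_boot all_order all_algebra.

Set Implicit Arguments.
Unset Strict Implicit.
Unset Printing Implicit Defensive.

Import GRing.Theory.
Local Open Scope ring_scope.

(* A Z_2-grading V = V_0 (+) V_1, given by its two projections; degrees are    *)
(* booleans (false = even, true = odd), so that addition of degrees is (+)     *)
(* (addb) and their product is &&. V need not be finite-dimensional.           *)
HB.mixin Record isSuperspace (K : fieldType) V of GRing.Lmodule K V := {
  comp : bool -> {linear V -> V};
  comp_comp : forall i j (v : V),
    comp i (comp j v) = if i == j then comp j v else 0;
  comp_sum : forall v : V, comp false v + comp true v = v
}.

#[short(type="superspaceType")]
HB.structure Definition Superspace (K : fieldType) :=
  {V of GRing.Lmodule K V & isSuperspace K V}.

(* v lies in V_i; the zero vector is homogeneous of both degrees. *)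
Definition homog (K : fieldType) (V : superspaceType K) (i : bool) (v : V) : Prop :=
  comp i v = v.

Lemma homog_comp (K : fieldType) (V : superspaceType K) i (v : V) :
  homog i (comp i v).
Proof. by rewrite /homog comp_comp eqxx. Qed.

Lemma comp_homog (K : fieldType) (V : superspaceType K) i j (v : V) :
  homog i v -> comp j v = if j == i then v else 0.
Proof. by move=> hv; rewrite -{1}hv comp_comp; case: eqP => // _. Qed.

Definition even_bilinear (K : fieldType) (U V W : superspaceType K)
    (f : U -> V -> W) : Prop :=
  forall i j u v, homog i u -> homog j v -> homog (i (+) j) (f u v).

Record lieSuperalgebra (K : fieldType) (L : superspaceType K) := LieSuperalgebra {
  bracket : {bilinear L -> L -> L};
  bracket_even : even_bilinear bracket;
  bracket_skew : forall i j x y, homog i x -> homog j y ->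
    bracket x y = - ((-1) ^+ (i && j) *: bracket y x);
  bracket_jacobi : forall i j k x y z, homog i x -> homog j y -> homog k z ->
      (-1) ^+ (i && k) *: bracket x (bracket y z)
    + (-1) ^+ (j && i) *: bracket y (bracket z x)
    + (-1) ^+ (k && j) *: bracket z (bracket x y) = 0
}.

(* No unit is required. *)
Record superalgebra (K : fieldType) (A : superspaceType K) := Superalgebra {
  smul : {bilinear A -> A -> A};
  smul_even : even_bilinear smul;
  smulA : forall a b c, smul a (smul b c) = smul (smul a b) c;
  smulC : forall i j a b, homog i a -> homog j b ->
    smul a b = (-1) ^+ (i && j) *: smul b a
}.

(* D is a homogeneous superderivation of degree i. *)
Definition superderivation (K : fieldType) (A : superspaceType K)
    (M : superalgebra A) (i : bool) (D : A -> A) : Prop :=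
  (forall j a, homog j a -> homog (i (+) j) (D a)) /\
  (forall j a b, homog j a ->
     D (smul M a b) = smul M (D a) b + (-1) ^+ (i && j) *: smul M a (D b)).

Definition representation (K : fieldType) (L V : superspaceType K)
    (G : lieSuperalgebra L) (mu : L -> V -> V) : Prop :=
  even_bilinear mu /\
  (forall i j x y v, homog i x -> homog j y ->
     mu (bracket G x y) v = mu x (mu y v) - (-1) ^+ (i && j) *: mu y (mu x v)).

Record lieRinehart (K : fieldType) (L A : superspaceType K) := LieRinehart {
  lr_lie :> lieSuperalgebra L;
  lr_alg : superalgebra A;
  act : {bilinear A -> L -> L};
  act_even : even_bilinear act;
  actA : forall a b x, act (smul lr_alg a b) x = act a (act b x);
  anchor : {bilinear L -> A -> A};
  anchor_der : forall i x, homog i x -> superderivation lr_alg i (anchor x);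
  anchor_rep : representation lr_lie anchor;
  anchor_act : forall a x b, anchor (act a x) b = smul lr_alg a (anchor x b);
  bracket_act : forall i j x a y, homog i x -> homog j a ->
    bracket lr_lie x (act a y)
    = act (anchor x a) y + (-1) ^+ (j && i) *: act a (bracket lr_lie x y)
}.

Definition supertrace (K : fieldType) (L : superspaceType K)
    (G : lieSuperalgebra L) (tau : L -> K) : Prop :=
  (forall x, homog true x -> tau x = 0) /\ (forall x y, tau (bracket G x y) = 0).

Section Twist.
Variables (K : fieldType) (L : superspaceType K) (tau : L -> K).

(* The sign rule formula is prescribed on homogeneous elements and extended    *)
(* additively: see twist3E and twist2E. With beta the bracket of L, twist3     *)
(* gives [x, y, z]_tau; with beta = phi_i (and W = K^o) it gives psi_i.        *)
Definition twist3 (W : lmodType K) (beta : L -> L -> W) (x y z : L) : W :=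
  \sum_(i : bool) \sum_(j : bool) \sum_(k : bool)
    let: (x, y, z) := (comp i x, comp j y, comp k z) in
    tau x *: beta y z
    - (-1) ^+ (i && j) *: (tau y *: beta x z)
    + (-1) ^+ (k && (i (+) j)) *: (tau z *: beta x y).

Definition twist2 (A : lmodType K) (mu : L -> A -> A) (x y : L) (a : A) : A :=
  \sum_(i : bool) \sum_(j : bool)
    let: (x, y) := (comp i x, comp j y) in
    tau x *: mu y a - (-1) ^+ (i && j) *: (tau y *: mu x a).

End Twist.

Lemma twist3E (K : fieldType) (L : superspaceType K) (tau : {scalar L})
    (W : lmodType K) (beta : {bilinear L -> L -> W}) i j k x y z :
  homog i x -> homog j y -> homog k z ->
  twist3 tau beta x y z =
    tau x *: beta y z
    - (-1) ^+ (i && j) *: (tau y *: beta x z)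
    + (-1) ^+ (k && (i (+) j)) *: (tau z *: beta x y).
Proof.
move=> hx hy hz; rewrite /twist3 (bigD1 i) //= (bigD1 j) //= (bigD1 k) //=.
rewrite hx hy hz !big1 ?addr0 // => [i' | j' | k'] /negPf ne.
- apply: big1 => j' _; apply: big1 => k' _.
  by rewrite (comp_homog _ hx) ne !linear0 !linear0l !(scale0r, scaler0) ?subr0 ?addr0.
- apply: big1 => k' _.
  by rewrite (comp_homog _ hy) ne !linear0 !linear0l !(scale0r, scaler0) ?subr0 ?addr0.
by rewrite (comp_homog _ hz) ne !linear0 !(scale0r, scaler0) ?subr0 ?addr0.
Qed.

Lemma twist2E (K : fieldType) (L A : superspaceType K) (tau : {scalar L})
    (mu : {bilinear L -> A -> A}) i j x y a :
  homog i x -> homog j y ->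
  twist2 tau mu x y a =
    tau x *: mu y a - (-1) ^+ (i && j) *: (tau y *: mu x a).
Proof.
move=> hx hy; rewrite /twist2 (bigD1 i) //= (bigD1 j) //=.
rewrite hx hy !big1 ?addr0 // => [i' | j'] /negPf ne.
- apply: big1 => j' _.
  by rewrite (comp_homog _ hx) ne !linear0 !linear0l !(scale0r, scaler0) ?subr0 ?addr0.
by rewrite (comp_homog _ hy) ne !linear0 !linear0l !(scale0r, scaler0) ?subr0 ?addr0.
Qed.

(* The operations of a 3-Lie-Rinehart superalgebra (L, A, [.,.,.], rho),       *)
(* without its axioms, which the scalar coboundary does not involve.           *)
Record ternaryStructure (K : fieldType) (L A : superspaceType K) := TernaryStructure {
  bracket3 : L -> L -> L -> L;
  anchor3 : L -> L -> A -> A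
}.

Definition induced (K : fieldType) (L A : superspaceType K)
    (R : lieRinehart L A) (tau : L -> K) : ternaryStructure L A :=
  {| bracket3 := twist3 tau (bracket R); anchor3 := twist2 tau (anchor R) |}.

Definition psi (K : fieldType) (L : superspaceType K) (tau : L -> K)
    (phi : L -> L -> K) : L -> L -> L -> K :=
  twist3 tau (phi : L -> L -> K^o).

Lemma psiE (K : fieldType) (L : superspaceType K) (tau : {scalar L})
    (phi : {biscalar L}) i j k x y z :
  homog i x -> homog j y -> homog k z ->
  psi tau phi x y z =
    tau x * phi y z
    - (-1) ^+ (i && j) * (tau y * phi x z)
    + (-1) ^+ (k && (i (+) j)) * (tau z * phi x y).
Proof. exact: (@twist3E K L tau K^o phi). Qed.

Section Cohomology.
Variables (K : fieldType) (L A : superspaceType K).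

Definition super_skew (phi : L -> L -> K) : Prop :=
  forall i j x y, homog i x -> homog j y ->
    phi x y = - ((-1) ^+ (i && j) * phi y x).

(* phi is in Z^2_LR(L, K); it is not assumed to be homogeneous. *)
Definition cocycle_LR (R : lieRinehart L A) (phi : {biscalar L}) : Prop :=
  super_skew phi /\
  (forall i j k x1 x2 x3, homog i x1 -> homog j x2 -> homog k x3 ->
     phi (bracket R x1 x2) x3
     - (-1) ^+ (j && k) * phi (bracket R x1 x3) x2
     + (-1) ^+ (i && (j (+) k)) * phi (bracket R x2 x3) x1 = 0).

Definition delta_LR (R : lieRinehart L A) (nu : L -> K) (x y : L) : K :=
  nu (bracket R x y).

Definition delta_3LR (T : ternaryStructure L A) (nu : L -> K) (x y z : L) : K :=
  nu (bracket3 T x y z).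

Definition cohomologous_LR (R : lieRinehart L A) (phi1 phi2 : L -> L -> K) : Prop :=
  exists nu : {scalar L},
    forall x y, phi2 x y - phi1 x y = delta_LR R nu x y.

Definition cohomologous_3LR (T : ternaryStructure L A)
    (psi1 psi2 : L -> L -> L -> K) : Prop :=
  exists nu : {scalar L},
    forall x y z, psi2 x y z - psi1 x y z = delta_3LR T nu x y z.

End Cohomology.

(* Main.v *)
(* The twist by tau is linear in the twisted map and commutes with linear maps, *)
(* so the same nu works: psi_2 - psi_1 is the twist of phi_2 - phi_1 = nu o     *)
(* [., .], which is nu o [., ., .]_tau.                                         *)
Require Import Defs.
From HB Require Import structures.
From mathcomp Require Import all_boot all_order all_algebra.

Set Implicit Arguments.
Unset Strict Implicit.
Unset Printing Implicit Defensive.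

Import GRing.Theory.
Local Open Scope ring_scope.

(** For fixed [tau] and arguments, [twist3] is a linear combination of values of [beta] whose
    coefficients involve only [tau] and degree signs. Hence it respects differences ([twist3B]) and
    passes through any linear map ([linear_twist3]), so a primitive [nu] of [phi2 - phi1] is also
    one of [psi2 - psi1]. *)

Section TwistLinearity.
Variables (K : fieldType) (L : superspaceType K) (tau : L -> K).

Lemma twist3B (W : lmodType K) (beta1 beta2 : L -> L -> W) x y z :
  twist3 tau beta2 x y z - twist3 tau beta1 x y z =
  twist3 tau (fun u v => beta2 u v - beta1 u v) x y z.
Proof.
rewrite /twist3 -sumrB; apply: eq_bigr => i _.
rewrite -sumrB; apply: eq_bigr => j _; rewrite -sumrB; apply: eq_bigr => k _.
rewrite opprD addrACA !scalerBr; congr (_ + _).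
by rewrite opprD addrACA -opprD.
Qed.

(** The signs depend only on the degrees of the arguments, so [f] may mix parities. *)
Lemma linear_twist3 (V W : lmodType K) (f : {linear V -> W})
    (beta : L -> L -> V) x y z :
  f (twist3 tau beta x y z) = twist3 tau (fun u v => f (beta u v)) x y z.
Proof.
rewrite /twist3 linear_sum; apply: eq_bigr => i _.
rewrite linear_sum; apply: eq_bigr => j _.
rewrite linear_sum; apply: eq_bigr => k _.
by rewrite linearD linearB !(linearZ_LR f).
Qed.

(** Allows a pointwise identity to be used under the twist without functional extensionality. *)
Lemma eq_twist3 (W : lmodType K) (beta1 beta2 : L -> L -> W) x y z :
  beta1 =2 beta2 -> twist3 tau beta1 x y z = twist3 tau beta2 x y z.
Proof.
move=> eq_beta; rewrite /twist3; apply: eq_bigr => i _.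
by apply: eq_bigr => j _; apply: eq_bigr => k _; rewrite !eq_beta.
Qed.

End TwistLinearity.

Theorem proposition3p12 (K : fieldType) (L A : superspaceType K)
    (R : lieRinehart L A) (tau : {scalar L})
    (tau_supertrace : supertrace R tau)
    (tau_act : forall (i j k : bool) (x y : L) (a : A),
       homog i x -> homog j y -> homog k a ->
       tau (act R a x) *: y = tau x *: act R a y)
    (phi1 phi2 : {biscalar L})
    (phi1_cocycle : cocycle_LR R phi1) (phi2_cocycle : cocycle_LR R phi2) :
  cohomologous_LR R phi1 phi2 ->
  cohomologous_3LR (induced R tau) (psi tau phi1) (psi tau phi2).
Proof.
case=> nu phiB; exists nu => x y z.
rewrite /psi (@twist3B K L tau K^o) /delta_3LR /=.
(* [K^o] is [K] as a module over itself, which makes the form [nu] a linear map between modules. *)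
rewrite (@linear_twist3 K L tau L K^o nu).
exact: (@eq_twist3 K L tau K^o _ _ x y z phiB).
Qed.
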